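(* For every integer $d\geq 4$ and every integer $k\geq 2$, the generic $d$-dimensional rigidity matroid $\mathcal{R}_d$ does not have the $k$-fold circuit property; that is, there exists a positive integer $n$ such that $\mathcal{R}_d(K_n)$ (the generic $d$-dimensional rigidity matroid on the edge set of the complete graph $K_n$) has a $k$-fold circuit which is not balanced.
   Context: Let $\mathcal{M}=(E,r)$ be a matroid on a finite set $E$ with rank function $r$ and closure operator $\mathrm{cl}(X)=\{x\in E: r(X\cup\{x\})=r(X)\}$. A set $D\subseteq E$ is cyclic if it is a union of circuits (equivalently $r(D-e)=r(D)$ for all $e\in D$). For an integer $k\geq 0$, a $k$-fold circuit of $\mathcal{M}$ is a cyclic set $D$ with $r(D)=|D|-k$. If $D$ is a $k$-fold circuit with $k\ge1$, its principal partition is the partition $\{A_1,\dots,A_\ell\}$ of $D$ such that $\{D\setminus A_i: 1\le i\le \ell\}$ is exactly the set of all $(k-1)$-fold circuits of $\mathcal{M}$ contained in $D$. A $k$-fold circuit $D$ with principal partition $\{A_1,\dots,A_\ell\}$ is balanced if $r\big(\bigcap_{i=1}^\ell \mathrm{cl}(D\setminus A_i)\big)=\ell-k$. A matroid has the $k$-fold circuit property if all its $k$-fold circuits are balanced. For a graph $G=(V,E)$ and a generic $p:V\to\mathbb{R}^d$ (coordinates algebraically independent over $\mathbb{Q}$), the rigidity matrix $R(G,p)$ is the $|E|\times d|V|$ matrix whose row for $uv\in E$ has $p(u)-p(v)$ in the $d$ columns of $u$, $p(v)-p(u)$ in the $d$ columns of $v$, and zeros elsewhere. The generic $d$-dimensional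 rigidity matroid $\mathcal{R}_d(G)$ is the row matroid of $R(G,p)$ on $E$ (independent of the generic choice of $p$). $\mathcal{R}_d$ refers to the family $\mathcal{R}_d(K_n)$, $n\ge1$. *)

(* Defs.v *)
From mathcomp Require Import all_boot all_order all_algebra.
From mathcomp Require Import reals.
From mathcomp Require Import mpoly.
Set Implicit Arguments. Unset Strict Implicit. Unset Printing Implicit Defensive.
Import GRing.Theory Num.Theory.
Local Open Scope ring_scope.

Section MatroidDefs.
Variable E : finType.
Variable r : {set E} -> nat.

Definition mcl (X : {set E}) : {set E} := [set x | r (x |: X) == r X].

Definition cyclic (D : {set E}) : bool := [forall e in D, r (D :\ e) == r D].

Definition kfold_circuit (k : nat) (D : {set E}) : bool :=
  cyclic D && (r D + k == #|D|)%N.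

(* principal partition of a k-fold circuit D: the sets A = D \ D' where D' ranges
   over the (k-1)-fold circuits contained in D (so that {D \ A} is exactly the set
   of (k-1)-fold circuits contained in D). *)
Definition principal_partition (k : nat) (D : {set E}) : {set {set E}} :=
  [set D :\: D' | D' in [set D' : {set E} | (D' \subset D) && kfold_circuit k.-1 D']].

Definition balanced (k : nat) (D : {set E}) : bool :=
  let P := principal_partition k D in
  ((r (\bigcap_(A in P) mcl (D :\: A)))%:Z == (#|P|)%:Z - k%:Z).

End MatroidDefs.

Definition Kedge (n : nat) := {e : 'I_n * 'I_n | (e.1 < e.2)%N}.

Section Rigidity.
Variables (R : realType) (n d : nat).

(* a placement p : V -> R^d is an n x d matrix whose row u is p(u) *)

(* row of the rigidity matrix for edge uv, arranged as an n x d matrix (block w = columns of w) *)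
Definition rig_row_mx (p : 'M[R]_(n, d)) (e : Kedge n) : 'M[R]_(n, d) :=
  let u := (val e).1 in let v := (val e).2 in
  \matrix_(w < n, j < d)
     (if w == u then p u j - p v j else if w == v then p v j - p u j else 0).

Definition rig_row (p : 'M[R]_(n, d)) (e : Kedge n) : 'rV[R]_(n * d) :=
  mxvec (rig_row_mx p e).

Definition rig_rank (p : 'M[R]_(n, d)) (F : {set Kedge n}) : nat :=
  \rank (\big[addsmx/0]_(e in F) <<rig_row p e>>)%MS.

Definition generic (p : 'M[R]_(n, d)) : Prop :=
  forall q : mpoly.mpoly (n * d) rat, q != 0 ->
    mpoly.mmap (fun c : rat => ratr c) (fun i : 'I_(n * d) => mxvec p 0 i) q != 0.

End Rigidity.

(* Main.v *)
Require Import Defs.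
From mathcomp Require Import all_boot all_order all_algebra.
From mathcomp Require Import reals.
From mathcomp Require Import mpoly.

(** Let D be the disjoint union of K_{d+2,d+3}, with sides X and B, and of
    k-2 copies of K_{d+2}, placed generically.  A stress of D assigns to each edge a weight
    in equilibrium at each vertex.  Following Bolker and Roth, the squares of the 2d+5
    points of X and B are linearly independent in Sym^2 (R^{d+1}) as soon as d >= 4, which
    forces the stresses of K_{X,B} to be tensor products of affine dependencies of X and
    of B; a copy of K_{d+2} carries a single stress.  Hence D is a k-fold circuit, and
    deleting the star of a vertex of B, or one of the copies of K_{d+2}, leaves a
    (k-1)-fold circuit: the principal partition has at least k+d+1 parts.  On the other
    hand, no edge lies in the closures of all these (k-1)-fold circuits: an edge meeting B
    or a copy of K_{d+2} is pendant after a suitable deletion, and an edge joining two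
    points of X is excluded because their product is independent from the squares.  So the
    intersection of the closures has rank 0, instead of a positive number. *)

Set Implicit Arguments. Unset Strict Implicit. Unset Printing Implicit Defensive.
Import GRing.Theory Num.Theory.
Local Open Scope ring_scope.

(** * Dependencies and rank *)

Section RigidityMatroid.
Variables (R : realType) (n d : nat) (p : 'M[R]_(n, d)).
Implicit Types (F T : {set Kedge n}) (c : Kedge n -> R) (e : Kedge n).

Definition rig_span F : 'M[R]_(n * d) := (\big[addsmx/0]_(e in F) <<rig_row p e>>)%MS.

(** The coefficients live on all edges and vanish off [F], so the same function can be read on
    different edge sets. *)
Definition dependency c F : Prop :=
  (forall e, e \notin F -> c e = 0) /\ \sum_e c e *: rig_row p e = 0.

Lemma dependencyS c F T : F \subset T -> dependency c F -> dependency c T.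
Proof.
move=> /subsetP FT [cF c0]; split=> // e eT; apply: cF.
by apply: contraNN eT; apply: FT.
Qed.

Lemma rig_row_sub e F : e \in F -> (rig_row p e <= rig_span F)%MS.
Proof.
by move=> eF; rewrite -(genmxE (rig_row p e)); apply: (sumsmx_sup e).
Qed.

Lemma rig_span_sub F m (A : 'M_(m, n * d)) :
  (forall e, e \in F -> (rig_row p e <= A)%MS) -> (rig_span F <= A)%MS.
Proof. by move=> FA; apply/sumsmx_subP => e /FA; rewrite genmxE. Qed.

Lemma rig_span_setU1 e F :
  (rig_span (e |: F) <= rig_span F + rig_row p e)%MS.
Proof.
apply: rig_span_sub => f /setU1P[->|fF]; first exact: addsmxSr.
exact: submx_trans (rig_row_sub fF) (addsmxSl _ _).
Qed.

Lemma rig_rank_subset F T : F \subset T -> (rig_rank p F <= rig_rank p T)%N.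
Proof.
move=> /subsetP FT; apply: mxrankS; apply: rig_span_sub => e /FT.
exact: rig_row_sub.
Qed.

Lemma rig_spanP F (u : 'rV_(n * d)) : (u <= rig_span F)%MS ->
  exists2 c, (forall e, e \notin F -> c e = 0) & u = \sum_e c e *: rig_row p e.
Proof.
case/sub_sumsmxP=> v uE.
have vE e : exists a : R, v e *m <<rig_row p e>>%MS = a *: rig_row p e.
  have: (v e *m <<rig_row p e>> <= rig_row p e)%MS.
    by rewrite (submx_trans (submxMl _ _)) ?genmxE.
  by case/submxP=> b ->; exists (b 0 0); rewrite {1}[b]mx11_scalar mul_scalar_mx.
have [a aE] := fin_all_exists vE.
exists (fun e => if e \in F then a e else 0) => [e /negPf->//|].
rewrite uE [LHS]big_mkcond; apply: eq_bigr => e _.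
by case: ifP => _; rewrite ?aE ?scale0r.
Qed.

Lemma dependency_sub c e F : dependency c (e |: F) -> c e != 0 ->
  (rig_row p e <= rig_span (F :\ e))%MS.
Proof.
move=> [cF c0] ce; move: c0; rewrite (bigD1 e) //=.
move/eqP; rewrite addr_eq0 => /eqP rE.
rewrite -(eqmx_scale _ ce) rE eqmx_opp.
apply: summx_sub => f fe; have [fF|fF] := boolP (f \in F).
  by apply/scalemx_sub/rig_row_sub; rewrite !inE fe.
by rewrite cF ?scale0r ?sub0mx // !inE negb_or fe.
Qed.

Lemma sub_dependency e F : e \notin F -> (rig_row p e <= rig_span F)%MS ->
  exists2 c, dependency c (e |: F) & c e != 0.
Proof.
move=> eF /rig_spanP[c cF rE]; exists (fun f => if f == e then -1 else c f).
  split=> [f|]; first by rewrite !inE negb_or; case: eqP => //= _ /cF.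
  rewrite (bigD1 e) //= eqxx scaleN1r rE [X in - X + _](bigD1 e) //= cF //.
  rewrite scale0r add0r; apply/eqP; rewrite addrC subr_eq0; apply/eqP.
  by apply: eq_bigr => f /negPf->.
by rewrite eqxx oppr_eq0 oner_neq0.
Qed.

Lemma mem_mcl e F : (e \in mcl (rig_rank p) F) -> (rig_row p e <= rig_span F)%MS.
Proof.
rewrite inE => /eqP rE; apply: submx_trans (rig_row_sub (setU11 e F)) _.
have sF : (rig_span F <= rig_span (e |: F))%MS.
  by apply: rig_span_sub => f fF; apply/rig_row_sub/setU1r.
by rewrite -(geq_leqif (mxrank_leqif_sup sF)); apply: (eq_leq rE).
Qed.

(** Induction on the size of [F]: if adding back an edge [e] did not raise the rank, then [e] would
    lie in the closure of the rest, giving a dependency nonzero at [e]. *)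
Lemma rig_rank_independent F :
  (forall c, dependency c F -> forall e, c e = 0) -> rig_rank p F = #|F|.
Proof.
elim: {F}_.+1 {-2}F (ltnSn #|F|) => // m IHm F; rewrite ltnS => Fm cF.
have [->|[e eF]] := set_0Vmem F.
  by rewrite cards0 /rig_rank big_set0 mxrank0.
have eF' : e \notin F :\ e by rewrite setD11.
have IH : rig_rank p (F :\ e) = #|F :\ e|.
  apply: IHm => [|c [cF' c0]]; first by rewrite (leq_trans _ Fm) // (cardsD1 e F) eF.
  by apply: cF; split=> // f fF; rewrite cF' // !inE negb_and fF orbT.
rewrite (cardsD1 e F) eF add1n -IH -{1}(setD1K eF); apply/eqP.
rewrite eqn_leq; apply/andP; split.
  apply: leq_trans (mxrankS (rig_span_setU1 _ _)) _.
  apply: leq_trans (mxrank_adds_leqif _ _) _.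
  by rewrite -[(rig_rank _ _).+1]addn1 leq_add2l rank_leq_row.
rewrite ltnNge; apply/negP => le_r.
have: e \in mcl (rig_rank p) (F :\ e).
  by rewrite inE eqn_leq le_r rig_rank_subset ?subsetUr.
move/mem_mcl/(sub_dependency eF') => [c]; rewrite setD1K // => /cF-> .
by rewrite eqxx.
Qed.

(** Each row outside [T] is solved for in a dependency where its coefficient is nonzero, so [T]
    spans the same space as [F]. *)
Lemma rig_rank_basis F T : T \subset F ->
  (forall e, e \in F :\: T ->
     exists2 c, dependency c (e |: T) & c e != 0) ->
  rig_rank p F = rig_rank p T.
Proof.
move=> TF cF; apply/eqP; rewrite eqn_leq andbC rig_rank_subset //=.
apply: mxrankS; apply: rig_span_sub => e eF.
have [eT|eT] := boolP (e \in T); first exact: rig_row_sub.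
have [|c cT ce] := cF e; first by rewrite inE eT.
apply: submx_trans (dependency_sub cT ce) _.
by apply: rig_span_sub => f; rewrite inE => /andP[_]; apply: rig_row_sub.
Qed.

Lemma cyclic_dependency F :
  (forall e, e \in F -> exists2 c, dependency c F & c e != 0) ->
  cyclic (rig_rank p) F.
Proof.
move=> cF; apply/forall_inP => e eF; apply/eqP; apply/esym.
apply: rig_rank_basis; first exact: subsetDl.
move=> f; rewrite setDDr setDv set0U inE => /andP[fF].
rewrite inE => /eqP->; have [c cF' ce] := cF e eF.
by exists c => //; rewrite setD1K.
Qed.

End RigidityMatroid.

(** * Equilibrium stresses *)

Section Barycentric.
Variables (K : comPzRingType) (d : nat).
Implicit Types (x y : 'I_d -> K).

(* Barycentric coordinates with respect to the standard simplex [0, e_1, ..., e_d]. *)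
Definition bary x (i : 'I_d.+1) : K :=
  if unlift ord0 i is Some j then x j else 1 - \sum_j x j.

Lemma sum_bary x : \sum_i bary x i = 1.
Proof.
rewrite big_ord_recl [bary x ord0]/bary unlift_none.
rewrite [X in _ + X](eq_bigr x) ?subrK // => j _.
by rewrite /bary liftK.
Qed.

Lemma bary_surj (a : 'I_d.+1 -> K) : \sum_i a i = 1 ->
  bary (fun j => a (lift ord0 j)) =1 a.
Proof.
move=> a1 i; rewrite /bary; case: unliftP => [j ->//|->].
by rewrite -a1 big_ord_recl addrK.
Qed.

End Barycentric.

Lemma rmorph_bary (K L : comPzRingType) (f : {rmorphism K -> L}) d
    (x : 'I_d -> K) i : f (bary x i) = bary (fun j => f (x j)) i.
Proof. by rewrite /bary; case: unlift => // ; rewrite rmorphB rmorph1 rmorph_sum. Qed.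

Section Stress.
Variables (R : realType) (V : finType) (d : nat) (p : 'M[R]_(#|V|, d)).
Implicit Types (F : {set Kedge #|V|}) (w : V -> V -> R) (c : Kedge #|V| -> R).
Implicit Types (e f : Kedge #|V|) (x y : V).

Definition end1 e : V := enum_val (val e).1.
Definition end2 e : V := enum_val (val e).2.
Definition joins e x y :=
  ((end1 e == x) && (end2 e == y)) || ((end1 e == y) && (end2 e == x)).
Definition coords x (i : 'I_d.+1) : R := bary (p (enum_rank x)) i.

(** The diagonal values [w x x] are free, as their terms vanish; this admits symmetric products of
    vectors as stresses. *)
Definition stress w : Prop :=
  (forall x y, w x y = w y x) /\
  (forall x i, \sum_y w x y * (coords y i - coords x i) = 0).

Lemma end_neq e : end1 e != end2 e.
Proof.
by apply/eqP => /enum_val_inj E; have := valP e; rewrite E ltnn.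
Qed.

Lemma joinsC e x y : joins e x y = joins e y x.
Proof. by rewrite /joins orbC. Qed.

Lemma joins_ends e : joins e (end1 e) (end2 e).
Proof. by rewrite /joins !eqxx. Qed.

Lemma joins_inj e f x y : joins e x y -> joins f x y -> e = f.
Proof.
move=> He Hf; apply: val_inj; apply/eqP; rewrite -pair_eqE /pair_eq /=.
rewrite -!(inj_eq enum_val_inj) -/(end1 e) -/(end2 e) -/(end1 f) -/(end2 f).
have He' := valP e; have Hf' := valP f.
have E1 g : (val g).1 = enum_rank (end1 g) by rewrite enum_valK.
have E2 g : (val g).2 = enum_rank (end2 g) by rewrite enum_valK.
move: He' Hf'; rewrite !E1 !E2.
case/orP: He => /andP[/eqP-> /eqP->]; case/orP: Hf => /andP[/eqP-> /eqP->];
  rewrite ?eqxx // => H1 H2; by have := ltn_trans H1 H2; rewrite ltnn.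
Qed.

Lemma exists_edge x y : x != y -> {e | joins e x y}.
Proof.
move=> xy; case: (ltngtP (enum_rank x) (enum_rank y)) => [lt|gt|eq].
- exists (exist (fun u : 'I_#|V| * 'I_#|V| => is_true (u.1 < u.2)%N)
            (enum_rank x, enum_rank y) lt).
  by rewrite /joins /end1 /end2 /= !enum_rankK !eqxx.
- exists (exist (fun u : 'I_#|V| * 'I_#|V| => is_true (u.1 < u.2)%N)
            (enum_rank y, enum_rank x) gt).
  by rewrite /joins /end1 /end2 /= !enum_rankK !eqxx orbT.
- by case/eqP: xy; apply/enum_rank_inj/val_inj.
Qed.

Definition weight c x y : R := \sum_(e | joins e x y) c e.

Lemma weightE c e x y : joins e x y -> weight c x y = c e.
Proof.
move=> exy; rewrite /weight (bigD1 e) //= big1 ?addr0 // => f /andP[fxy].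
by rewrite (joins_inj fxy exy) eqxx.
Qed.

Lemma weight_diag c x : weight c x x = 0.
Proof.
rewrite /weight big_pred0 // => e; apply/negP => /orP[]/andP[/eqP E1 /eqP E2];
  by have := end_neq e; rewrite E1 E2 eqxx.
Qed.

Lemma rig_row_mxE e x j :
  rig_row_mx p e (enum_rank x) j =
  \sum_(y | joins e x y) (p (enum_rank x) j - p (enum_rank y) j).
Proof.
rewrite mxE.
have E1 : (val e).1 = enum_rank (end1 e) by rewrite enum_valK.
have E2 : (val e).2 = enum_rank (end2 e) by rewrite enum_valK.
rewrite E1 E2 !(inj_eq enum_rank_inj).
have ne := end_neq e.
have [->|x1] := eqVneq x (end1 e).
  rewrite (big_pred1 (end2 e)) // => y.
  by rewrite /joins eqxx (eq_sym (end2 e) (end1 e)) (negPf ne) andbF orbF eq_sym.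
have [->|x2] := eqVneq x (end2 e).
  rewrite (big_pred1 (end1 e)) // => y.
  by rewrite /joins eqxx (negPf ne) andbT /= eq_sym.
rewrite big_pred0 // => y.
by rewrite /joins ![end1 e == x]eq_sym (negPf x1) ![end2 e == x]eq_sym (negPf x2) andbF.
Qed.

Lemma sum_rig_rowE c : \sum_e c e *: rig_row p e =
  mxvec (\matrix_(u, j) \sum_y weight c (enum_val u) y * (p u j - p (enum_rank y) j)).
Proof.
rewrite /rig_row; under eq_bigr do rewrite -linearZ.
rewrite -linear_sum; congr mxvec; apply/matrixP => u j.
rewrite -[u]enum_valK; move: (enum_val u) => x.
rewrite summxE !mxE enum_rankK.
under eq_bigr do rewrite mxE rig_row_mxE big_distrr big_mkcond /=.
rewrite exchange_big; apply: eq_bigr => y _.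
by rewrite /weight -big_mkcond big_distrl.
Qed.

(** The coordinate at [ord0] is 1 minus the sum of the others, so its equation follows from theirs,
    which agree with those of [p] up to sign. *)
Lemma coordsB w x :
  (forall i, \sum_y w x y * (coords y i - coords x i) = 0) <->
  (forall j, \sum_y w x y * (p (enum_rank x) j - p (enum_rank y) j) = 0).
Proof.
have N a b : a = - b -> (a = 0 <-> b = 0 :> R).
  by move=> ->; split=> [/eqP|->]; rewrite ?oppr0 // oppr_eq0 => /eqP.
have lE j : \sum_y w x y * (coords y (lift ord0 j) - coords x (lift ord0 j)) =
            - \sum_y w x y * (p (enum_rank x) j - p (enum_rank y) j).
  rewrite -sumrN; apply: eq_bigr => y _.
  by rewrite /coords /bary liftK -mulrN opprB.
split=> [H j|H i]; first by apply/(N _ _ (lE j)).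
have [j ->|->] := unliftP ord0 i; first by apply/(N _ _ (lE j)).
transitivity (\sum_j \sum_y w x y * (p (enum_rank x) j - p (enum_rank y) j)).
  rewrite exchange_big; apply: eq_bigr => y _.
  rewrite -big_distrr /= sumrB /coords /bary unlift_none; congr (_ * _).
  by rewrite opprB addrC addrA subrK.
by rewrite big1.
Qed.

Lemma dependency_stress c F : dependency p c F -> stress (weight c).
Proof.
case=> _; rewrite sum_rig_rowE => c0; split=> [x y|x].
  by apply: eq_bigl => e; rewrite joinsC.
apply/coordsB => j; move/(canRL mxvecK): c0 => /matrixP/(_ (enum_rank x) j).
by rewrite mxE enum_rankK linear0 mxE.
Qed.

Lemma stress_dependency w F : stress w ->
  (forall e, e \notin F -> w (end1 e) (end2 e) = 0) ->
  dependency p (fun e => w (end1 e) (end2 e)) F.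
Proof.
move=> [wC w0] wF; split=> //; rewrite sum_rig_rowE -[RHS](linear0 mxvec).
congr mxvec; apply/matrixP => u j; rewrite !mxE -[u]enum_valK.
move: (enum_val u) => x; rewrite enum_rankK.
rewrite -[RHS](proj1 (coordsB w x) (w0 x) j); apply: eq_bigr => y _.
have [->|/exists_edge[e exy]] := eqVneq x y; first by rewrite subrr !mulr0.
congr (_ * _); rewrite (weightE _ exy).
by case/orP: exy => /andP[/eqP-> /eqP->].
Qed.

End Stress.

(** * Generic independence *)

Definition free_on (K : pzRingType) (I J : finType) (S : {set I}) (M : I -> J -> K) : Prop :=
  forall c : I -> K, (forall i, i \notin S -> c i = 0) ->
    (forall j, \sum_i c i * M i j = 0) -> forall i, c i = 0.

Lemma free_onPn (K : fieldType) (I J : finType) (S : {set I}) (M : I -> J -> K) :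
  ~~ row_free (\matrix_(i < #|S|, j < #|J|) M (enum_val i) (enum_val j)) ->
  exists c : I -> K, [/\ forall i, i \notin S -> c i = 0,
    forall j, \sum_i c i * M i j = 0 & exists i, c i != 0].
Proof.
set A := \matrix_(i, j) _; rewrite -kermx_eq0 => /rowV0Pn[u /sub_kermxP uA u0].
pose c i := \sum_(s < #|S|) u 0 s * (enum_val s == i)%:R.
have cE s : c (enum_val s) = u 0 s.
  rewrite /c (bigD1 s) //= eqxx mulr1 big1 ?addr0 // => t ts.
  by rewrite (inj_eq enum_val_inj) (negPf ts) mulr0.
have cS i : i \notin S -> c i = 0.
  move=> iS; rewrite /c big1 // => s _; case: eqP => [E|]; last by rewrite mulr0.
  by rewrite -E enum_valP in iS.
exists c; split=> // [j|]; last first.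
  by case/rV0Pn: u0 => s us; exists (enum_val s); rewrite cE.
rewrite (bigID (mem S)) /= [X in _ + X]big1 ?addr0 => [|i /cS->]; last by rewrite mul0r.
rewrite big_enum_val -[RHS](_ : (u *m A) 0 (enum_rank j) = 0); last by rewrite uA mxE.
by rewrite mxE; apply: eq_bigr => s _; rewrite cE mxE enum_rankK.
Qed.

Lemma free_onP (K : fieldType) (I J : finType) (S : {set I}) (M : I -> J -> K) :
  free_on S M <->
  row_free (\matrix_(i < #|S|, j < #|J|) M (enum_val i) (enum_val j)).
Proof.
split=> [SM|SA c cS c0 i].
  apply: contraT => /free_onPn[c [cS c0 [i]]].
  by rewrite (SM c cS c0 i) eqxx.
have [iS|/cS//] := boolP (i \in S).
have /rowP/(_ (enum_rank_in iS i)) : \row_s c (@enum_val _ (mem S) s) = 0.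
  apply: (row_free_inj SA); rewrite mul0mx; apply/rowP => j.
  rewrite !mxE -[RHS](c0 (enum_val j)) [RHS](bigID (mem S)) /= [X in _ = _ + X]big1 ?addr0.
    by rewrite [RHS]big_enum_val; apply: eq_bigr => s _; rewrite !mxE.
  by move=> k /cS->; rewrite mul0r.
by rewrite !mxE enum_rankK_in.
Qed.

(** * Transfer of independence from a rational special position to a generic placement *)

Section Genericity.
Variables (R : realType) (n d : nat) (p : 'M[R]_(n, d)).
Hypothesis p_generic : generic p.

(* A polynomial matrix that is row-free at a rational point [w] has there a right
   inverse [B] with rational entries; [det (M *m B)] is then a nonzero polynomial. *)
Lemma generic_free_on (I J : finType) (S : {set I}) (Q : I -> J -> {mpoly rat[n * d]})
    (w : 'I_(n * d) -> rat) :
  free_on S (fun i j => (Q i j).@[w]) ->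
  free_on S (fun i j => mmap (ratr : rat -> R) (mxvec p 0) (Q i j)).
Proof.
move/free_onP/row_freeP => [B AB]; apply/free_onP.
pose M := \matrix_(i < #|S|, j < #|J|) Q (enum_val i) (enum_val j).
pose q := \det (M *m map_mx (@mpolyC (n * d) rat) B).
have q_neq0 : q != 0.
  apply/eqP => q0; have := congr1 (meval w) q0.
  rewrite -det_map_mx map_mxM -map_mx_comp.
  set B' := map_mx _ B; have -> : B' = B.
    by apply/matrixP => i j; rewrite mxE /= mevalC.
  rewrite (_ : map_mx _ M = \matrix_(i, j) (Q (enum_val i) (enum_val j)).@[w]).
    by rewrite AB det1 meval0 => /eqP; rewrite oner_eq0.
  by apply/matrixP => i j; rewrite !mxE.
have := p_generic q_neq0.
rewrite -[X in X != 0]/(mmap (ratr : rat -> R) (mxvec p 0) q) -det_map_mx map_mxM.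
rewrite -unitfE -[_ \is a _]/(_ \in unitmx) -row_free_unit.
set C := map_mx _ M => CB.
rewrite (_ : \matrix_(i, j) _ = C); last by apply/matrixP => i j; rewrite !mxE.
rewrite -kermx_eq0; apply/rowV0P => u /sub_kermxP uC.
by apply: (row_free_inj CB); rewrite mulmxA uC !mul0mx.
Qed.

End Genericity.

(** * Affine and quadratic independence of generic points *)

Section GenericPlacement.
Variables (R : realType) (V : finType) (d : nat) (p : 'M[R]_(#|V|, d)).
Hypothesis p_generic : generic p.
Local Notation coords := (coords p).

(** Coordinates of a placement with indeterminate entries: [mmap] specialises them to [p],
    evaluation to a rational placement. *)
Definition symbolic_coords (x : V) (i : 'I_d.+1) : {mpoly rat[#|V| * d]} :=
  bary (fun j => 'X_(mxvec_index (enum_rank x) j)) i.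

Lemma mmap_symbolic x i :
  mmap (ratr : rat -> R) (mxvec p 0) (symbolic_coords x i) = coords x i.
Proof.
rewrite rmorph_bary /coords /bary.
case: unlift => [j|]; first by rewrite /= mmapX mmap1U mxvecE.
by congr (1 - _); apply: eq_bigr => j _; rewrite /= mmapX mmap1U mxvecE.
Qed.

Lemma meval_symbolic (a : V -> 'I_d.+1 -> rat) : (forall x, \sum_i a x i = 1) ->
  exists w, forall x i, (symbolic_coords x i).@[w] = a x i.
Proof.
move=> a1.
exists (mxvec (\matrix_(u < #|V|, j < d) a (enum_val u) (lift ord0 j)) 0) => x i.
rewrite rmorph_bary -(bary_surj (a1 x)) /bary.
case: unlift => [j|]; first by rewrite /= mevalXU mxvecE mxE enum_rankK.
by congr (1 - _); apply: eq_bigr => j _; rewrite /= mevalXU mxvecE mxE enum_rankK.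
Qed.

(** In the special position used, the points of [S] are distinct vertices of the standard
    simplex. *)
Lemma coords_free (S : {set V}) : (#|S| <= d.+1)%N -> free_on S coords.
Proof.
move=> Sd; pose f x : 'I_d.+1 := inord (index x (enum S)).
have fS x y : x \in S -> y \in S -> f x = f y -> x = y.
  rewrite -!(mem_enum S) => xS yS /(congr1 val); rewrite /= !inordK.
  - by move/(congr1 (nth x (enum S))); rewrite !nth_index.
  - by rewrite (leq_trans _ Sd) // cardE index_mem.
  - by rewrite (leq_trans _ Sd) // cardE index_mem.
have [|w wE] := @meval_symbolic (fun x i => (i == f x)%:R).
  by move=> x; rewrite (bigD1 (f x)) //= eqxx big1 ?addr0 // => i /negPf->.
have := @generic_free_on _ _ _ _ p_generic V 'I_d.+1 S symbolic_coords w.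
move=> H c cS c0; apply: H cS _ => [{c0}c cS c0 x|i]; last first.
  by rewrite -[RHS](c0 i); apply: eq_bigr => x _; rewrite mmap_symbolic.
have [xS|/cS//] := boolP (x \in S).
rewrite -[RHS](c0 (f x)) (bigD1 x) //= wE eqxx mulr1 big1 ?addr0 // => y yx.
rewrite wE; case: eqP => [/esym E|]; last by rewrite mulr0.
have [yS|/cS->] := boolP (y \in S); last by rewrite mul0r.
by rewrite (fS _ _ yS xS E) eqxx in yx.
Qed.


(** There are more vectors than dimensions, so a dependency exists; it vanishes nowhere on [S]
    because any d+1 of the points are independent. *)
Lemma affine_dependency (S : {set V}) : #|S| = d.+2 ->
  exists c : V -> R, [/\ forall x, (c x != 0) = (x \in S), \sum_x c x = 0
    & forall i, \sum_x c x * coords x i = 0].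
Proof.
move=> Sd.
have [|c [cS c0 [y cy]]] := @free_onPn R V 'I_d.+1 S coords.
  by rewrite /row_free neq_ltn (leq_ltn_trans (rank_leq_col _)) // Sd card_ord.
exists c; split=> // [x|].
  apply/idP/idP => [|xS]; first by apply: contraNT => /cS->.
  apply: contraNneq cy => cx; apply/eqP.
  apply: (@coords_free (S :\ x)) => //.
    by have := cardsD1 x S; rewrite xS Sd add1n => -[<-].
  by move=> z; rewrite !inE negb_and negbK => /orP[/eqP->|/cS].
(* The coordinates of each point sum to 1, so adding up the d+1 linear relations yields the affine
   one. *)
transitivity (\sum_i \sum_x c x * coords x i); last by rewrite big1.
rewrite exchange_big; apply: eq_bigr => x _.
by rewrite -big_distrr /= [X in _ * X](sum_bary (p (enum_rank x))) mulr1.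
Qed.

(** Each row of the symmetrised tensor product is a combination of [c] and [c'], and an affine
    dependency annihilates every translate of the points. *)
Lemma outer_stress (c c' : V -> R) :
  \sum_x c x = 0 -> (forall i, \sum_x c x * coords x i = 0) ->
  \sum_x c' x = 0 -> (forall i, \sum_x c' x * coords x i = 0) ->
  stress p (fun x y => c x * c' y + c' x * c y).
Proof.
move=> c0 ci c'0 c'i; split=> [x y|x i]; first by rewrite addrC mulrC [c x * _]mulrC.
have H b : \sum_x b x = 0 -> (forall i, \sum_x b x * coords x i = 0) ->
    \sum_y b y * (coords y i - coords x i) = 0.
  move=> b0 bi; under eq_bigr do rewrite mulrBr.
  by rewrite sumrB bi -big_distrl /= b0 mul0r subr0.
under eq_bigr do rewrite mulrDl -!mulrA.
by rewrite big_split /= -!big_distrr /= !H // !mulr0 addr0.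
Qed.

(** The points of [x |: N] are affinely independent, so equilibrium at [x] is possible only with
    zero weights. *)
Lemma stress_small (w : V -> V -> R) x (N : {set V}) :
  stress p w -> (forall y, y \notin x |: N -> w x y = 0) -> (#|x |: N| <= d.+1)%N ->
  forall y, y != x -> w x y = 0.
Proof.
move=> [_ w0] wN Nd y yx.
(* Subtracting the total weight at [x] itself turns the equilibrium equation into a linear
   dependency of coordinate vectors. *)
pose c z := w x z - (z == x)%:R * \sum_z w x z.
suff : c y = 0 by rewrite /c (negPf yx) mul0r subr0.
apply: (coords_free Nd) => [z zN|i].
  rewrite /c (wN z zN); move: zN; rewrite !inE negb_or => /andP[/negPf-> _].
  by rewrite mul0r subrr.
rewrite -[RHS](w0 x i) /c; under eq_bigr do rewrite mulrBl.
under [RHS]eq_bigr do rewrite mulrBr.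
rewrite !sumrB; congr (_ - _); rewrite [LHS](bigD1 x) //= eqxx mul1r [X in _ + X]big1 ?addr0.
  by rewrite big_distrl.
by move=> z /negPf->; rewrite !mul0r.
Qed.

Lemma weight_neq0 c F x y : dependency p c F -> weight c x y != 0 ->
  exists2 e, e \in F & joins e x y.
Proof.
move=> [cF _] wxy; have xy : x != y by apply: contraNneq wxy => ->; rewrite weight_diag.
have [e exy] := exists_edge xy; exists e => //.
by apply: contraNT wxy => /cF ce; rewrite (weightE _ exy) ce.
Qed.

(** In [e |: F] the vertex [x] has the single neighbour [y], so equilibrium at [x] kills the weight
    of [e]. *)
Lemma pendant_notin_mcl (F : {set Kedge #|V|}) e x y :
  (0 < d)%N -> joins e x y -> (forall f z, f \in F -> ~~ joins f x z) ->
  e \notin mcl (rig_rank p) F.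
Proof.
move=> d0 exy Fx; apply/negP => /mem_mcl eF.
have [|c cF ce] := sub_dependency _ eF; first by apply: contraL exy; apply: Fx.
have cS := dependency_stress cF.
have xy : x != y by apply: contraNneq ce => xy; rewrite -(weightE c exy) xy weight_diag.
have := stress_small (x := x) (N := [set y]) cS.
move=> /(_ _ _ y); rewrite (weightE _ exy) eq_sym => H.
case/negP: ce; apply/eqP/H => //; last by rewrite cards2 xy.
move=> z; rewrite !inE negb_or => /andP[_ zy]; apply/eqP; apply: contraNT zy.
case/(weight_neq0 cF) => f /setU1P[->|fF] fxz; last by rewrite (negPf (Fx f z fF)) in fxz.
move: exy fxz; rewrite /joins => /orP[]/andP[/eqP-> /eqP->];
  rewrite ?eqxx ?(negPf xy) ?[y == x]eq_sym ?(negPf xy) ?andbF ?andbT ?orbF //=.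
all: by rewrite eq_sym.
Qed.

(* The squares of the points of [W], together with the symmetric product of [a] and [a'],
   are linearly independent in Sym^2.  In the special position used, the points are the
   barycentres of faces with one or two vertices, [a] and [a'] being vertices and the edge
   between them being left out, so that each off-diagonal entry sees a single element. *)
Lemma squares_free (W : {set V}) (a a' : V) (c : V -> R) (t : R) :
  (0 < d)%N -> a \in W -> a' \in W -> a != a' -> (#|W| <= 'C(d.+1, 2) + d)%N ->
  (forall x, x \notin W -> c x = 0) ->
  (forall i j, \sum_x c x * (coords x i * coords x j)
     + t * (coords a i * coords a' j + coords a' i * coords a j) = 0) ->
  t = 0 /\ forall x, c x = 0.
Proof.
move=> d_gt0 aW a'W aa' Wd cW c0.
(* [None] indexes the symmetric product of [a] and [a'], [Some x] the square of [x]. *)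
pose Q (o : option V) (ij : 'I_d.+1 * 'I_d.+1) :=
  let h := symbolic_coords in
  if o is Some x then h x ij.1 * h x ij.2
  else h a ij.1 * h a' ij.2 + h a' ij.1 * h a ij.2.
pose S := None |: Some @: W.
have SomeS x : (Some x \in S) = (x \in W).
  by rewrite !inE /= (mem_imset _ _ Some_inj).
have sum_opt (K : nmodType) (F : option V -> K) : \sum_o F o = F None + \sum_x F (Some x).
  rewrite (bigD1 None) //=; congr (_ + _).
  rewrite (reindex_omap Some id) => [|[]//]; apply: eq_bigl => x.
  by rewrite /= eqxx.
suff [w Qw] : exists w, free_on S (fun o ij => (Q o ij).@[w]).
  have := generic_free_on p_generic Qw.
  move/(_ (fun o => if o is Some x then c x else t)) => H.
  suff H0 o : (if o is Some x then c x else t) = 0.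
    by split=> [|x]; [apply: (H0 None) | apply: (H0 (Some x))].
  apply: H => [[x|]|[i j]]; first by rewrite SomeS => /cW.
    by rewrite setU11.
  rewrite sum_opt -[RHS](c0 i j) addrC; congr (_ + _).
    by apply: eq_bigr => x _; rewrite /= rmorphM /= !mmap_symbolic.
  by rewrite /= rmorphD !rmorphM /= !mmap_symbolic.
pose i0 : 'I_d.+1 := ord0; pose i1 : 'I_d.+1 := ord_max.
have i01 : i0 != i1 by rewrite -val_eqE /= eq_sym -lt0n.
pose E1 := [set A : {set 'I_d.+1} | #|A| == 1%N].
pose E2 := [set A : {set 'I_d.+1} | #|A| == 2%N].
(* The available faces; [S2] also sets aside the two vertices reserved for [a] and [a']. *)
pose S1 := (E1 :|: E2) :\ [set i0; i1].
pose S2 := S1 :\ [set i0] :\ [set i1].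
pose W2 := W :\ a :\ a'.
have set1_neq : [set i0] != [set i1] :> {set 'I_d.+1}.
  by apply/eqP => /setP/(_ i0); rewrite !inE eqxx (negPf i01).
have v0 : [set i0] \in S1.
  rewrite !inE cards1 eqxx /= andbT; apply/eqP => /(congr1 (fun A : {set _} => #|A|)).
  by rewrite cards1 cards2 i01.
have v1 : [set i1] \in S1.
  rewrite !inE cards1 eqxx /= andbT; apply/eqP => /(congr1 (fun A : {set _} => #|A|)).
  by rewrite cards1 cards2 i01.
(* There are d+1 vertices and 'C(d+1, 2) edges, less the omitted edge: exactly the bound assumed on
   [W]. *)
have le_W2 : (#|W2| <= #|S2|)%N.
  have E12 : [set i0; i1] \in E1 :|: E2 by rewrite !inE cards2 i01 orbT.
  have c12 : #|E1 :|: E2| = (d.+1 + 'C(d.+1, 2))%N.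
    rewrite cardsU (_ : E1 :&: E2 = set0) ?cards0 ?subn0.
      by rewrite !card_draws card_ord bin1.
    by apply/setP => A; rewrite !inE; apply/negP => /andP[/eqP->].
  have := cardsD1 [set i0; i1] (E1 :|: E2); rewrite E12 c12 -/S1.
  rewrite (cardsD1 [set i0] S1) v0 (cardsD1 [set i1] (S1 :\ _))
    in_setD1 eq_sym set1_neq v1 -/S2.
  move: Wd; rewrite (cardsD1 a W) aW (cardsD1 a' (W :\ a)) in_setD1 eq_sym aa' a'W -/W2 /=.
  by rewrite [('C(_, _) + d)%N]addnC !addSn !add0n => + [E]; rewrite E.
(* On [W2] the default of [nth] is never reached; points outside [W] get an arbitrary face, their
   coefficient being 0. *)
pose f x := if x \in W2 then nth [set i0] (enum S2) (index x (enum W2))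
            else if x == a' then [set i1] else [set i0].
have fa : f a = [set i0] by rewrite /f !inE eqxx andbF (negPf aa').
have fa' : f a' = [set i1] by rewrite /f !inE eqxx.
have f_lt x : x \in W2 -> (index x (enum W2) < size (enum S2))%N.
  by move=> xW; rewrite -cardE (leq_trans _ le_W2) // cardE index_mem mem_enum.
have f_mem x : x \in W2 -> f x \in S2.
  by move=> xW; rewrite /f xW -(mem_enum S2) mem_nth ?f_lt.
have f_S1 x : f x \in S1.
  have [xW|xW] := boolP (x \in W2).
    by have := f_mem x xW; rewrite !inE => /and3P[_ _ ->].
  by rewrite /f (negPf xW); case: ifP.
have f_inj : {in W &, injective f}.
  have W_split x : x \in W -> [\/ x = a, x = a' | x \in W2].
    move=> xW; rewrite !inE xW andbT.
    by do 2![case: eqP => [->|_]; first by [constructor]]; constructor 3.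
  have f2 x : x \in W2 -> (f x != [set i0]) && (f x != [set i1]).
    by move/f_mem; rewrite !in_setD1 => /and3P[-> ->].
  move=> x y /W_split[->|->|xW] /W_split[->|->|yW] //; rewrite ?fa ?fa'.
  - by move/eqP; rewrite (negPf set1_neq).
  - by move=> E; have := f2 y yW; rewrite -E eqxx.
  - by move/eqP; rewrite eq_sym (negPf set1_neq).
  - by move=> E; have := f2 y yW; rewrite -E eqxx andbF.
  - by move=> E; have := f2 x xW; rewrite E eqxx.
  - by move=> E; have := f2 x xW; rewrite E eqxx andbF.
  rewrite /f xW yW => /eqP; rewrite nth_uniq ?f_lt ?enum_uniq // => /eqP.
  by move/(congr1 (nth a (enum W2))); rewrite !nth_index ?mem_enum.
have f12 x : #|f x| = 1%N \/ #|f x| = 2%N.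
  by have := f_S1 x; rewrite !inE => /andP[_ /orP[]/eqP->]; [left|right].
have f_gt0 x : (#|f x|)%:R != 0 :> rat.
  by rewrite pnatr_eq0; case: (f12 x) => ->.
pose al x i : rat := (i \in f x)%:R / #|f x|%:R.
have [|w wE] := @meval_symbolic al.
  move=> x; rewrite -big_distrl /= -natr_sum.
  rewrite (_ : (\sum_i (i \in f x))%N = #|f x|) ?divff //.
  by rewrite -sum1_card [RHS]big_mkcond; apply: eq_bigr => i _; case: (_ \in _).
have al_neq0 x i : (al x i != 0) = (i \in f x).
  by rewrite mulf_eq0 invr_eq0 (negPf (f_gt0 x)) orbF; case: (_ \in _).
exists w => {t c cW c0} c cS c0.
have cW x : x \notin W -> c (Some x) = 0 by move=> xW; apply: cS; rewrite SomeS.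
have {c0}c0 i j : c None * (al a i * al a' j + al a' i * al a j)
                  + \sum_x c (Some x) * (al x i * al x j) = 0.
  rewrite -[RHS](c0 (i, j)) sum_opt; congr (_ + _).
    by rewrite /= !(rmorphD, rmorphM) /= !wE.
  by apply: eq_bigr => x _; rewrite /= rmorphM /= !wE.
have f_pair x i j : i != j -> i \in f x -> j \in f x -> f x = [set i; j].
  move=> ij ix jx; apply/esym/eqP; rewrite eqEcard subUset !sub1set ix jx /=.
  by rewrite cards2 ij; case: (f12 x) => ->.
(* No square has a nonzero entry at [(i0, i1)], whose edge was omitted, while the product of [a] and
   [a'] has entry 1 there. *)
have cN : c None = 0.
  have := c0 i0 i1; rewrite big1 ?addr0 => [|x _].
    rewrite /al fa fa' !inE !eqxx (negPf i01) [i1 == i0]eq_sym (negPf i01) !cards1.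
    by rewrite divr1.
  apply/eqP/negPn/negP; rewrite 2!mulf_eq0 !negb_or !al_neq0 => /and3P[_ x0 x1].
  have E := f_pair x _ _ i01 x0 x1.
  by have := f_S1 x; rewrite in_setD1 E eqxx.
have sum_c i j x : i \in f x -> j \in f x -> x \in W ->
   (forall y, y \in W -> i \in f y -> j \in f y -> c (Some y) != 0 -> y = x) ->
   c (Some x) = 0.
  move=> ix jx xW uniq_x; have := c0 i j; rewrite cN mul0r add0r (bigD1 x) //= big1.
    rewrite addr0 => /eqP; rewrite 2!mulf_eq0 -[al x i == 0]negbK al_neq0 ix.
    by rewrite -[al x j == 0]negbK al_neq0 jx !orbF => /eqP.
  move=> y yx; have [yW|/cW->] := boolP (y \in W); last by rewrite mul0r.
  apply/eqP; apply: contraNT yx; rewrite 2!mulf_eq0 !negb_or !al_neq0.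
  by case/and3P=> cy iy jy; apply/eqP/uniq_x.
(* Edges are handled first: the entry at two distinct vertices sees only the face they span. *)
have c2 x : x \in W -> #|f x| = 2%N -> c (Some x) = 0.
  move=> xW /eqP/cards2P[i] [j] [ij fx]; apply: (sum_c i j) => //;
    rewrite ?fx ?inE ?eqxx ?orbT //.
  by move=> y yW iy jy _; apply: f_inj; rewrite // fx; apply: f_pair.
case=> [x|]; last exact: cN.
have [xW|xW] := boolP (x \in W); last exact: cW.
case: (f12 x) => fx; last exact: c2.
(* With the edges gone, a diagonal entry sees only its own vertex. *)
case/eqP/cards1P: fx => i fx; apply: (sum_c i i) => //; rewrite ?fx ?inE ?eqxx //.
move=> y yW iy _ cy; apply: f_inj; rewrite // fx.
case: (f12 y) => fy; last by rewrite c2 ?eqxx in cy.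
by move/eqP/cards1P: fy iy => [j ->]; rewrite inE => /eqP->.
Qed.

End GenericPlacement.

(** * An unbalanced k-fold circuit *)

Lemma exists_subset_card (T : finType) (A : {set T}) k :
  (k <= #|A|)%N -> exists2 B : {set T}, B \subset A & #|B| = k.
Proof.
move=> kA; exists [set x in take k (enum A)].
  by apply/subsetP => x; rewrite inE => /mem_take; rewrite mem_enum.
by rewrite cardsE (card_uniqP (take_uniq _ (enum_uniq _))) size_takel // -cardE.
Qed.

(** This makes room for the squares of the 2d+5 points of X and B; the inequality fails at d = 3. *)
Lemma bin2_ge d : (3 < d)%N -> (d + 5 <= 'C(d.+1, 2))%N.
Proof.
elim: d => // d IH; rewrite leq_eqVlt => /orP[/eqP<-//|d3].
by rewrite binS bin1 addSn -addn1 leq_add ?IH.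
Qed.

Section Construction.
Variables (R : realType) (d m : nat).
Hypothesis d_ge4 : (3 < d)%N.

Definition vtx : finType := ('I_d.+2 + 'I_d.+3 + 'I_m * 'I_d.+2)%type.
Definition idx : finType := ('I_d.+3 + 'I_m)%type.

Notation va a := (inl (inl a) : vtx).
Notation vb b := (inl (inr b) : vtx).

(* The graph is the union of K_{d+2,d+3} and [m] disjoint copies of K_{d+2}; its edges
   are partitioned into the stars of the vertices [vb b] and the [m] cliques. *)
Definition part (x y : vtx) : option idx :=
  match x, y with
  | inl (inl _), inl (inr b) | inl (inr b), inl (inl _) => Some (inl b)
  | inr u, inr v => if u.1 == v.1 then Some (inr u.1) else None
  | _, _ => None
  end.

Definition edges_in (Z : {set idx}) : {set Kedge #|vtx|} :=
  [set e | if part (end1 e) (end2 e) is Some i then i \in Z else false].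

(** A representative edge of each part. Deleting the tips of all parts but d+1 stars will leave a
    basis. *)
Definition tip (i : idx) : vtx * vtx :=
  match i with
  | inl b => (va ord0, vb b)
  | inr j => (inr (j, ord0), inr (j, ord_max))
  end.

Lemma tip_neq i : (tip i).1 != (tip i).2.
Proof. by case: i => //= j; apply/eqP => -[]. Qed.

Definition tip_edge i : Kedge #|vtx| := sval (exists_edge (tip_neq i)).

Lemma partC x y : part x y = part y x.
Proof. by case: x y => [[x|x]|x] [[y|y]|y] //=; rewrite eq_sym; case: eqP => // ->. Qed.

Lemma joins_edges_in e x y (Z : {set idx}) : joins e x y ->
  (e \in edges_in Z) = (if part x y is Some i then i \in Z else false).
Proof. by rewrite inE => /orP[]/andP[/eqP-> /eqP->] //; rewrite partC. Qed.

Lemma joins_tip i : joins (tip_edge i) (tip i).1 (tip i).2.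
Proof. exact: (svalP (exists_edge (tip_neq i))). Qed.

Lemma tip_edge_in i (Z : {set idx}) : (tip_edge i \in edges_in Z) = (i \in Z).
Proof. by rewrite (joins_edges_in _ (joins_tip i)); case: i => //= j; rewrite eqxx. Qed.

Lemma tip_edge_inj : injective tip_edge.
Proof.
move=> i j E; have := tip_edge_in j [set i].
by rewrite -E tip_edge_in !inE eqxx => /esym/eqP.
Qed.

Lemma edges_inS (Y Z : {set idx}) : Y \subset Z -> edges_in Y \subset edges_in Z.
Proof.
move=> /subsetP YZ; apply/subsetP => e; rewrite !inE.
by case: part => // i; apply: YZ.
Qed.

(** * Dependencies carried by the stars and the cliques *)

Variable p : 'M[R]_(#|vtx|, d).
Hypothesis p_generic : generic p.
Local Notation coords := (coords p).

(** The support is prescribed off the diagonal only, since the square of an affine dependency is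
    nonzero on it. *)
Lemma exists_dependency (Z : {set idx}) (w : vtx -> vtx -> R) : stress p w ->
  (forall x y, x != y -> (w x y != 0) = (if part x y is Some i then i \in Z else false)) ->
  exists2 c, dependency p c (edges_in Z) & forall e, e \in edges_in Z -> c e != 0.
Proof.
move=> wS wZ; have wE e : (w (end1 e) (end2 e) != 0) = (e \in edges_in Z).
  by rewrite (joins_edges_in _ (joins_ends e)) wZ ?end_neq.
exists (fun e => w (end1 e) (end2 e)) => [|e]; last by rewrite wE.
by apply: stress_dependency => // e; rewrite -wE negbK => /eqP.
Qed.

(** X and [S] both have d+2 points; the product of their affine dependencies is supported on all of
    K_{X,S}. *)
Lemma star_dependency (S : {set 'I_d.+3}) : #|S| = d.+2 ->
  exists2 c, dependency p c (edges_in (inl @: S)) &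
    forall e, e \in edges_in (inl @: S) -> c e != 0.
Proof.
move=> Sd; pose XS : {set vtx} := [set va a | a in [set: 'I_d.+2]].
pose BS : {set vtx} := [set vb b | b in S].
have [|l [lS l0 lc]] := affine_dependency p_generic (S := XS).
  by rewrite card_imset ?cardsT ?card_ord // => a b [].
have [|u [uS u0 uc]] := affine_dependency p_generic (S := BS).
  by rewrite card_imset // => a b [].
have lX a : l (va a) != 0 by rewrite lS imset_f.
have lB b : l (vb b) = 0.
  by apply/eqP/negPn; rewrite lS; apply/imsetP => -[].
have lY y : l (inr y) = 0.
  by apply/eqP/negPn; rewrite lS; apply/imsetP => -[].
have uX a : u (va a) = 0.
  by apply/eqP/negPn; rewrite uS; apply/imsetP => -[].
have uB b : (u (vb b) != 0) = (b \in S).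
  by rewrite uS mem_imset // => ? ? [].
have uY y : u (inr y) = 0.
  by apply/eqP/negPn; rewrite uS; apply/imsetP => -[].
apply: exists_dependency (outer_stress l0 lc u0 uc) _.
have inlS b : (inl b \in (inl @: S : {set idx})) = (b \in S).
  by rewrite mem_imset // => ? ? [].
move=> [[x|x]|x] [[y|y]|y] _ /=;
  rewrite ?lB ?lY ?uX ?uY ?(mul0r, mulr0, addr0, add0r) ?eqxx ?inlS //.
- by rewrite mulf_eq0 (negPf (lX x)) uB.
- by rewrite mulf_eq0 (negPf (lX y)) orbF uB.
- by case: eqP => // _; apply/esym/negbTE/imsetP => -[].
Qed.

(** The stress is twice the tensor square of the affine dependency of the d+2 points. *)
Lemma clique_dependency (j : 'I_m) :
  exists2 c, dependency p c (edges_in [set inr j]) &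
    forall e, e \in edges_in [set inr j] -> c e != 0.
Proof.
pose YS : {set vtx} := [set inr (j, y) | y in [set: 'I_d.+2]].
have [|l [lS l0 lc]] := affine_dependency p_generic (S := YS).
  by rewrite card_imset ?cardsT ?card_ord // => a b [].
have lI x : l (inl x) = 0.
  by apply/eqP/negPn; rewrite lS; apply/imsetP => -[].
have lY y : (l (inr y) != 0) = (y.1 == j).
  rewrite lS; apply/imsetP/eqP => [[z _ [->]] //|<-].
  by exists y.2 => //; case: y.
apply: exists_dependency (outer_stress l0 lc l0 lc) _.
move=> [x|x] [y|y] _ /=; rewrite ?lI ?(mul0r, mulr0, addr0, add0r) ?eqxx //.
- by case: x y => x [] y; rewrite ?inE.
- by case: x.
rewrite -mulr2n -mulr_natl !mulf_eq0 pnatr_eq0 /= negb_or !lY.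
have [<-|] := eqVneq x.1 j.
  by rewrite /= eq_sym; case: eqP => //= _; rewrite inE eqxx.
by move=> /negPf xj; case: (x.1 =P y.1) => //= _; rewrite inE;
  apply/esym/eqP => -[/eqP]; rewrite xj.
Qed.

Lemma cyclic_edges_in (Z : {set idx}) : (d.+2 <= #|[set b | inl b \in Z]|)%N ->
  cyclic (rig_rank p) (edges_in Z).
Proof.
move=> Zd; apply: cyclic_dependency => e.
rewrite inE; case E: part => [i|//] iZ.
have {}E (Y : {set idx}) : (e \in edges_in Y) = (i \in Y) by rewrite inE E.
case: i => [b|j] in iZ E *.
- have [|B0] := @exists_subset_card _ ([set b | inl b \in Z] :\ b) d.+1.
    by move: Zd; rewrite (cardsD1 b) inE iZ.
  rewrite subsetD1 => /andP[/subsetP B0Z bB0] B0d.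
  have [|c cS cn] := @star_dependency (b |: B0).
    by rewrite cardsU1 bB0 B0d.
  exists c; last by apply: cn; rewrite E imset_f // setU11.
  apply: dependencyS cS; apply: edges_inS.
  by apply/subsetP => _ /imsetP[b' /setU1P[->|/B0Z +] ->] //; rewrite inE.
- have [c cS cn] := clique_dependency j.
  exists c; last by apply: cn; rewrite E set11.
  by apply: dependencyS cS; apply: edges_inS; rewrite sub1set.
Qed.

(** * Stresses of the bipartite part and the rank of the graph *)

Lemma stress_coords w x i : stress p w ->
  \sum_y w x y * coords y i = (\sum_y w x y) * coords x i.
Proof.
move=> [_ /(_ x i)]; under eq_bigr do rewrite mulrBr.
by rewrite sumrB -big_distrl /= => /eqP; rewrite subr_eq0 => /eqP.
Qed.

Lemma sum_two (I : finType) (K : zmodType) (a a' : I) (F : I -> I -> K) : a != a' ->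
  (forall x y, (x, y) != (a, a') -> (x, y) != (a', a) -> F x y = 0) ->
  \sum_x \sum_y F x y = F a a' + F a' a.
Proof.
move=> aa' F0; rewrite pair_big /= (bigD1 (a, a')) //= (bigD1 (a', a)) /=; last first.
  by rewrite -pair_eqE /= negb_and eq_sym aa'.
by rewrite big1 ?addr0 // => -[x y] /andP[/= ? ?]; apply: F0.
Qed.

(* Bolker-Roth: evaluating the tensor sum of w(x, y) x (x) y, for x in X and y in B,
   row-wise and column-wise yields a linear relation between the squares of the
   points and the product of a and a'. *)
Lemma bipartite_stress w (a a' : 'I_d.+2) : stress p w -> a != a' ->
  (forall b b', w (vb b) (vb b') = 0) -> (forall x y, w (inl x) (inr y) = 0) ->
  (forall x y, (x, y) != (a, a') -> (x, y) != (a', a) -> w (va x) (va y) = 0) ->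
  w (va a) (va a') = 0 /\ forall x, \sum_y w (inl x) y = 0.
Proof.
move=> wS aa' wBB wY wXX; have wC := wS.1.
pose s x := \sum_y w x y.
(* The squares enter with the vertex sums as coefficients, with opposite signs on X and B. *)
pose c (v : vtx) := match v with inl (inl _) => s v | inl (inr _) => - s v | inr _ => 0 end.
pose W : {set vtx} := [set inl x | x in [set: 'I_d.+2 + 'I_d.+3]].
have W_card : (#|W| <= 'C(d.+1, 2) + d)%N.
  rewrite card_imset ?cardsT ?card_sum ?card_ord; last by move=> ? ? [].
  rewrite (_ : d.+2 + d.+3 = d + 5 + d)%N ?leq_add2r ?bin2_ge //.
  by rewrite !(addnS, addSn, addn0).
have [] := @squares_free _ _ _ _ p_generic W (va a) (va a') c (- w (va a) (va a')).
- by apply: leq_trans d_ge4.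
- exact: imset_f.
- exact: imset_f.
- by apply: contraNneq aa' => -[->].
- exact: W_card.
- by move=> [x|//]; rewrite imset_f.
- move=> i j; rewrite !big_sumType /c /= [X in _ + _ + X + _]big1 ?addr0;
    last by move=> y _; rewrite mul0r.
  have SX x : s (va x) * coords (va x) i =
      \sum_y w (va x) (va y) * coords (va y) i + \sum_b w (va x) (vb b) * coords (vb b) i.
    rewrite -stress_coords // !big_sumType /= [X in _ + X]big1 ?addr0 // => y _.
    by rewrite wY mul0r.
  have SB b : s (vb b) * coords (vb b) j = \sum_x w (va x) (vb b) * coords (va x) j.
    rewrite -stress_coords // !big_sumType /= [X in _ + X]big1 ?addr0; last first.
      by move=> y _; rewrite wY mul0r.
    rewrite [X in _ + X]big1 ?addr0; last by move=> y _; rewrite wBB mul0r.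
    by apply: eq_bigr => x _; rewrite wC.
  (* [SX] expands one factor of each square of X; regrouping the mixed terms by [b] and applying
     [SB] gives the squares of B. *)
  have -> : \sum_x s (va x) * (coords (va x) i * coords (va x) j) =
      \sum_x \sum_y w (va x) (va y) * coords (va y) i * coords (va x) j +
      \sum_b s (vb b) * (coords (vb b) i * coords (vb b) j).
    under eq_bigr do rewrite mulrA SX mulrDl !big_distrl /=.
    rewrite big_split /=; congr (_ + _); rewrite exchange_big /=.
    apply: eq_bigr => b _; rewrite [coords (vb b) i * _]mulrC mulrA SB big_distrl /=.
    by apply: eq_bigr => x _; rewrite mulrAC.
  rewrite -[X in X + _]addrA -big_split /= [X in _ + X + _]big1 => [|b _]; last first.
    by rewrite mulNr subrr.
  rewrite addr0 (sum_two aa') => [|x y xa xa']; last by rewrite wXX // !mul0r.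
  by rewrite (wC (va a') (va a)) -!mulrA -mulrDr [coords (va a') i * _ + _]addrC mulNr subrr.
move=> /eqP; rewrite oppr_eq0 => /eqP-> c0; split=> // -[x|b].
  exact: (c0 (va x)).
by apply/eqP; rewrite -oppr_eq0; apply/eqP/(c0 (vb b)).
Qed.

(** The vertex sums on X and B vanish, so d+1 neighbours already force zero weights. A vertex of B
    outside [B0] has lost its edge to [va ord0]; then X sees only [B0]. In a clique, the loss of one
    edge kills the weights at [ord0], hence all the others. *)
Lemma basis_independent (B0 : {set 'I_d.+3}) (Z : {set idx}) c : #|B0| = d.+1 ->
  dependency p c (edges_in Z :\: [set tip_edge i | i in Z :\: inl @: B0]) ->
  forall e, c e = 0.
Proof.
move=> B0d cF; have wS := dependency_stress cF; have wC := wS.1.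
set w := weight c in wS wC.
have w_part x y : (if part x y is Some i then i \in Z else false) = false -> w x y = 0.
  move=> xyZ; apply/eqP/negPn/negP => /(weight_neq0 cF)[e].
  by rewrite inE => /andP[_ eZ] exy; rewrite (joins_edges_in _ exy) xyZ in eZ.
have w_tip i : i \notin inl @: B0 -> w (tip i).1 (tip i).2 = 0.
  move=> iB; apply/eqP/negPn/negP => /(weight_neq0 cF)[e].
  rewrite inE => /andP[/negP eT eZ] ei; apply: eT.
  have E := joins_inj ei (joins_tip i); rewrite E imset_f // inE iB.
  by rewrite -tip_edge_in -E.
have a01 : (ord0 : 'I_d.+2) != ord_max by [].
(* Here [w] vanishes on all pairs of X, so any two points may be chosen; only the vanishing of the
   vertex sums is kept. *)
have [|||_ s0] := @bipartite_stress w _ _ wS a01.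
- by move=> b b'; apply: w_part.
- by move=> [x|x] y; apply: w_part.
- by move=> x y _ _; apply: w_part.
have w_eq x i : \sum_y w (inl x) y * coords y i = 0.
  by rewrite stress_coords // s0 mul0r.
have star0 b a : b \notin B0 -> w (vb b) (va a) = 0.
  move=> bB; move: (va a).
  apply: (@coords_free _ _ _ _ p_generic [set va x | x in ~: [set ord0]]) => //.
    by rewrite card_imset ?cardsC1 ?card_ord // => ? ? [].
  move=> [[x|x]|x] xN; try exact: w_part.
  have -> : x = ord0; last first.
    by rewrite wC; apply: (w_tip (inl b)); rewrite mem_imset // => ? ? [].
  by apply/eqP; apply: contraNT xN => x0; rewrite imset_f // !inE.
have X0 a y : w (va a) y = 0.
  move: y; apply: (@coords_free _ _ _ _ p_generic [set vb b | b in B0]) => //.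
    by rewrite card_imset ?B0d // => ? ? [].
  move=> [[x|x]|x] xN; try exact: w_part.
  by rewrite wC star0 //; apply: contraNN xN => xB; rewrite imset_f.
have Y_small (j : 'I_m) (y y1 : 'I_d.+2) : y != y1 -> w (inr (j, y)) (inr (j, y1)) = 0 ->
    forall z, w (inr (j, y)) z = 0.
  move=> yy1 w1 z; have [->|] := eqVneq z (inr (j, y)); first exact: weight_diag.
  move: z; pose N : {set vtx} := [set inr (j, x) | x in ~: [set y1]].
  have xN : inr (j, y) |: N = N.
    by apply/setUidPr; rewrite sub1set imset_f // !inE.
  apply: (stress_small (N := N) p_generic wS); rewrite xN; last first.
    by rewrite card_imset ?cardsC1 ?card_ord // => ? ? [].
  move=> [x|[j' x]] zN; first by apply: w_part.
  have [Ej|jj'] := eqVneq j j'; last by apply: w_part; rewrite /= (negPf jj').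
  rewrite -{}Ej in zN *; suff -> : x = y1 by [].
  by apply/eqP; apply: contraNT zN => x1; rewrite imset_f // !inE.
have Y0 j z : w (inr (j, ord0)) z = 0.
  apply: (@Y_small j ord0 ord_max) => //; apply: (w_tip (inr j)).
  by apply/imsetP => -[].
have Y1 j y z : w (inr (j, y)) z = 0.
  have [->|y0] := eqVneq y ord0; first exact: Y0.
  by apply: (Y_small _ _ _ y0); rewrite wC Y0.
move=> e; rewrite -(weightE c (joins_ends e)) -/w.
case: (end1 e) => [[x|x]|[j x]]; [exact: X0| |exact: Y1].
by case: (end2 e) => [[y|y]|y]; [rewrite wC X0| apply: w_part|apply: w_part].
Qed.

(** Fix d+1 stars in [Z]. The tips of the other [#|Z| - d.+1] parts are the excess over a basis:
    each is restored by the stress of its clique, or of its star together with the fixed ones. *)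
Lemma kfold_edges_in (Z : {set idx}) : (d.+2 <= #|[set b | inl b \in Z]|)%N ->
  kfold_circuit (rig_rank p) (#|Z| - d.+1) (edges_in Z).
Proof.
move=> Zd; rewrite /kfold_circuit cyclic_edges_in //=.
have [B0 /subsetP B0Z B0d] := exists_subset_card (ltnW Zd).
have {}B0Z : inl @: B0 \subset Z.
  by apply/subsetP => _ /imsetP[b /B0Z + ->]; rewrite inE.
pose T := [set tip_edge i | i in Z :\: inl @: B0].
have TZ : T \subset edges_in Z.
  by apply/subsetP => _ /imsetP[i /setDP[iZ _] ->]; rewrite tip_edge_in.
have T_card : #|T| = (#|Z| - d.+1)%N.
  rewrite card_imset; last exact: tip_edge_inj.
  by rewrite cardsD (setIidPr B0Z) card_imset ?B0d // => ? ? [].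
have -> : rig_rank p (edges_in Z) = rig_rank p (edges_in Z :\: T).
  apply: rig_rank_basis; first exact: subsetDl.
  move=> e; rewrite setDDr setDv set0U inE => /andP[_ /imsetP[i /setDP[iZ iB] ->]].
  suff [Y iY [YZ [c cY cn]]] : exists2 Y : {set idx}, i \in Y & [/\ Y \subset i |: inl @: B0 &
      exists2 c, dependency p c (edges_in Y) & forall e, e \in edges_in Y -> c e != 0].
    exists c; last by apply: cn; rewrite tip_edge_in.
    apply: dependencyS cY; apply/subsetP => f fY; rewrite in_setU1 in_setD.
    (* The dependency uses only part [i] and the fixed stars, so it meets [T] in the tip of [i]
       alone. *)
    have [/imsetP[i' /setDP[i'Z i'B] E]|_] /= := boolP (f \in T); last first.
      apply/orP; right; apply: (subsetP (edges_inS _)) fY.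
      by apply: (subset_trans YZ); rewrite subUset sub1set iZ.
    rewrite orbF E; apply/eqP; congr tip_edge; move: fY; rewrite E tip_edge_in.
    by move/(subsetP YZ); rewrite in_setU1 (negPf i'B) orbF => /eqP.
  case: i => [b|j] in iZ iB *; last first.
    exists [set inr j]; first exact: set11.
    by split; [exact: subsetUl | exact: clique_dependency].
  exists (inl @: (b |: B0)); first by rewrite imset_f ?setU11.
  split; first by rewrite imsetU1.
  apply: star_dependency; rewrite cardsU1 B0d.
  by move: iB; rewrite mem_imset => [->|? ? []].
rewrite (rig_rank_independent (fun c => @basis_independent B0 Z c B0d)).
by rewrite -T_card -(cardsID T (edges_in Z)) (setIidPr TZ) addnC.
Qed.

(** * Closures of the deletions and failure of balance *)

Lemma star_mcl e b y : joins e (vb b) y ->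
  e \notin mcl (rig_rank p) (edges_in (~: [set inl b])).
Proof.
move=> eb; apply: (pendant_notin_mcl p_generic _ eb); first exact: leq_trans d_ge4.
move=> f z fF; apply/negP => fb; move: fF; rewrite (joins_edges_in _ fb).
by case: z {fb} => [[z|z]|z] //=; rewrite !inE eqxx.
Qed.

Lemma clique_mcl e u y : joins e (inr u) y ->
  e \notin mcl (rig_rank p) (edges_in (~: [set inr u.1])).
Proof.
move=> eu; apply: (pendant_notin_mcl p_generic _ eu); first exact: leq_trans d_ge4.
move=> f z fF; apply/negP => fu; move: fF; rewrite (joins_edges_in _ fu).
by case: z {fu} => [[z|z]|z] //=; case: ifP => // _; rewrite !inE eqxx.
Qed.

(** A dependency through [e] would be a stress whose only weight inside X is on [a], [a'], and
    [bipartite_stress] makes that weight zero. *)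
Lemma X_mcl e a a' (Z : {set idx}) : joins e (va a) (va a') ->
  e \notin mcl (rig_rank p) (edges_in Z).
Proof.
move=> ea; have aa' : a != a'.
  apply: contraTneq ea => ->; apply/negP => /orP[]/andP[/eqP E1 /eqP E2];
  by have := end_neq e; rewrite E1 E2 eqxx.
have eZ : e \notin edges_in Z by rewrite (joins_edges_in _ ea).
apply/negP => /mem_mcl/(sub_dependency eZ)[c cF ce].
have wS := dependency_stress cF.
have w0 x y : part x y = None -> (x, y) != (va a, va a') -> (x, y) != (va a', va a) ->
    weight c x y = 0.
  move=> xyN n1 n2; apply/eqP/negPn/negP => /(weight_neq0 cF)[f /setU1P[->|fZ] fxy].
    case/orP: fxy n1 n2 => /andP[/eqP <- /eqP <-];
    by case/orP: ea => /andP[/eqP-> /eqP->]; rewrite eqxx.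
  by move: fZ; rewrite (joins_edges_in _ fxy) xyN.
have [|||W0 _] := bipartite_stress wS aa'.
- by move=> b b'; apply: w0.
- by move=> [x|x] y; apply: w0 => //; rewrite xpair_eqE andbF.
- by move=> x y n1 n2; apply: w0.
by case/eqP: ce; rewrite -(weightE c ea).
Qed.

Lemma exists_notin_mcl e :
  exists i, e \notin mcl (rig_rank p) (edges_in (~: [set i])).
Proof.
have := joins_ends e; case: (end1 e) => [[x|x]|x] E;
  last by exists (inr x.1); apply: clique_mcl E.
- move: E; case: (end2 e) => [[y|y]|y] E.
  (* For an edge inside X any deletion will do. *)
  + by exists (inl ord0); apply: X_mcl E.
  + by exists (inl y); rewrite joinsC in E; apply: star_mcl E.
  + by exists (inr y.1); rewrite joinsC in E; apply: clique_mcl E.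
- by exists (inl x); apply: star_mcl E.
Qed.

Lemma kfold_circuit_edges : kfold_circuit (rig_rank p) m.+2 (edges_in [set: idx]).
Proof.
have -> : m.+2 = (#|[set: idx]| - d.+1)%N.
  by rewrite cardsT card_sum !card_ord -[d.+3]/(2 + d.+1)%N addnAC addnK.
apply: kfold_edges_in; rewrite (_ : [set b | _] = setT) ?cardsT ?card_ord //.
by apply/setP => b; rewrite !inE.
Qed.

Lemma kfold_circuit_edgesC1 i : kfold_circuit (rig_rank p) m.+1 (edges_in (~: [set i])).
Proof.
have -> : m.+1 = (#|~: [set i]| - d.+1)%N.
  by rewrite cardsC1 card_sum !card_ord -[(_).-1]/(1 + d.+1 + m)%N addnAC addnK.
apply: kfold_edges_in; case: i => [b|j].
  rewrite (_ : [set b | _] = ~: [set b]) ?cardsC1 ?card_ord //.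
  by apply/setP => b'; rewrite !inE (inj_eq inl_inj).
rewrite (_ : [set b | _] = setT) ?cardsT ?card_ord //.
by apply/setP => b'; rewrite !inE.
Qed.

Lemma unbalanced_edges : ~~ balanced (rig_rank p) m.+2 (edges_in [set: idx]).
Proof.
rewrite /balanced; set D := edges_in _; set P := principal_partition _ _ _.
pose A i := D :\: edges_in (~: [set i]).
have AP i : A i \in P.
  apply/imsetP; exists (edges_in (~: [set i])) => //.
  by rewrite inE kfold_circuit_edgesC1 edges_inS ?subsetT.
have A_inj : injective A.
  move=> i j E; have : tip_edge i \in A i by rewrite in_setD !tip_edge_in !inE eqxx.
  by rewrite E in_setD !tip_edge_in !inE negbK andbT => /eqP.
(* The sets [A i] are d+3+m distinct parts; this lower bound on the number of parts suffices. *)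
have P_gt : (m.+2 < #|P|)%N.
  apply: (@leq_trans #|A @: [set: idx]|); last first.
    by apply/subset_leq_card/subsetP => _ /imsetP[i _ ->]; apply: AP.
  by rewrite card_imset // cardsT card_sum !card_ord !addSn !ltnS leq_addl.
(* The empty intersection has rank 0, whereas balance would require the positive number
   [#|P| - m.+2]. *)
rewrite (_ : \bigcap_(_ in P) _ = set0).
  rewrite /rig_rank big_set0 mxrank0 eq_sym subr_eq0 eqz_nat neq_ltn.
  by rewrite P_gt orbT.
apply/setP => e; rewrite inE; apply/negP => /bigcapP eP.
have [i /negP] := exists_notin_mcl e; apply.
have := eP _ (AP i); rewrite /A setDDr setDv set0U (setIidPr _) //.
exact/edges_inS/subsetT.
Qed.

End Construction.

Theorem theorem3p7 (R : realType) (d k : nat) :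
  (4 <= d)%N -> (2 <= k)%N ->
  exists n : nat, (0 < n)%N /\
    forall p : 'M[R]_(n, d), generic p ->
      exists D : {set Kedge n},
        kfold_circuit (rig_rank p) k D /\ ~~ balanced (rig_rank p) k D.
Proof.
move=> d_ge4; case: k => [|[|m]] // _.
(* Here m = k-2 is the number of copies of K_{d+2}. *)
exists #|vtx d m|; split=> [|p p_generic].
  by rewrite !card_sum card_ord.
exists (edges_in [set: idx d m]).
by split; [apply: kfold_circuit_edges | apply: unbalanced_edges].
Qed.
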